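(* Let $\alpha>\beta>\gamma>0$. Let $\mathbf r=(x,y,z):U\cup U^*\to\mathbb R^3$, with $U\subset\mathbb Z^2$ and $U^*\subset(\mathbb Z^2)^*$, be the binet given by $$x(n_1,n_2)=\sqrt{\tfrac{\alpha}{(\alpha-\beta)(\alpha-\gamma)}}\,f_1(n_1)f_2(n_2),\quad y(n_1,n_2)=\sqrt{\tfrac{\beta}{(\alpha-\beta)(\beta-\gamma)}}\,g_1(n_1)g_2(n_2),\quad z(n_1,n_2)=\sqrt{\tfrac{\gamma}{(\alpha-\gamma)(\beta-\gamma)}}\,h_1(n_1)h_2(n_2),$$ where the real-valued functions $f_i,g_i,h_i$ satisfy $$f_1^{\mathbb 2}(n_1)+g_1^{\mathbb 2}(n_1)=\alpha-\beta,\quad f_1^{\mathbb 2}(n_1)+h_1^{\mathbb 2}(n_1)=\alpha-\gamma,$$ $$f_2^{\mathbb 2}(n_2)-g_2^{\mathbb 2}(n_2)=\alpha-\beta,\quad f_2^{\mathbb 2}(n_2)+h_2^{\mathbb 2}(n_2)=\alpha-\gamma .$$ Then: (i) $\mathbf r$ is a principal binet. (ii) For each vertex $\mathbf r(n_1,n_2)$, the plane $\Box(n_1,n_2)$ is its polar plane with respect to the classical ellipsoid $\frac{x^2}{\alpha}+\frac{y^2}{\beta}+\frac{z^2}{\gamma}=1$.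
   Context: Notation: $(\mathbb Z^2)^*=(\mathbb Z+\frac12)^2$, and $n^{\pm}=n\pm\frac12$. For a real function $f$ of a half-integer variable $n\in\frac12\mathbb Z$, the discrete square is $f^{\mathbb 2}(n)=f(n)f(n+\frac12)$ (it is not the ordinary square). The functions $f_i,g_i,h_i$ are defined on intervals $J_i$ of $\frac12\mathbb Z$ with $U\cup U^*\subset J_1\times J_2$, and the functional equations hold whenever $n_i,n_i+\frac12\in J_i$. A binet is a pair of discrete nets, i.e. a map $\mathbf r:U\cup U^*\to\mathbb R^3$ with $U\subset\mathbb Z^2$, $U^*\subset(\mathbb Z^2)^*$. A principal binet is a binet such that (1) all elementary quadrilaterals $(\mathbf r(n_1^-,n_2^-),\mathbf r(n_1^+,n_2^-),\mathbf r(n_1^+,n_2^+),\mathbf r(n_1^-,n_2^+))$ (whose index points lie in the domain) are planar; the corresponding plane is denoted $\Box(n_1,n_2)$; (2) all pairs of dual edges $(\mathbf r(n_1^-,n_2),\mathbf r(n_1^+,n_2))$ and $(\mathbf r(n_1,n_2^-),\mathbf r(n_1,n_2^+))$ are orthogonal. The polar plane of a point $(x_0,y_0,z_0)\neq 0$ with respect to the ellipsoid is the plane $\frac{x_0x}{\alpha}+\frac{y_0y}{\beta}+\frac{z_0z}{\gamma}=1$. *)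

(* Defs.v *)
From HB Require Import structures.
From mathcomp Require Import all_boot all_order all_algebra.
From mathcomp Require Import boolp classical_sets reals.
Set Implicit Arguments.
Unset Strict Implicit.
Unset Printing Implicit Defensive.
Import Order.TTheory GRing.Theory Num.Theory.
Local Open Scope classical_set_scope.
Local Open Scope ring_scope.

(* Index variables are rationals, restricted by predicates to (1/2)Z, Z or
   Z + 1/2, so that n + 1/2 and n - 1/2 are literal. Functions of an index are
   total; only their values on the stated domains are ever constrained. *)
Definition one_half : rat := 2^-1.

Definition half_integers : set rat := [set n | n *+ 2 \is a Num.int].

Definition Z2 : set (rat * rat) :=
  [set n | n.1 \is a Num.int /\ n.2 \is a Num.int].

Definition Z2_dual : set (rat * rat) :=
  [set n | n.1 - one_half \is a Num.int /\ n.2 - one_half \is a Num.int].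

(* Possibly empty, possibly unbounded. *)
Definition half_integer_interval (J : set rat) : Prop :=
  J `<=` half_integers /\
  forall a b c, J a -> J c -> half_integers b -> a <= b <= c -> J b.

(* This is not the ordinary square of f n. *)
Definition discrete_square (R : realType) (f : rat -> R) (n : rat) : R :=
  f n * f (n + one_half).

Definition vec3 (R : realType) (x y z : R) : 'rV[R]_3 :=
  \row_(i < 3) [:: x; y; z]`_i.

Definition dot (R : realType) (u v : 'rV[R]_3) : R :=
  \sum_(i < 3) u 0 i * v 0 i.

Definition is_plane (R : realType) (P : set 'rV[R]_3) : Prop :=
  exists (a : 'rV[R]_3) (c : R), a != 0 /\ P = [set p | dot a p = c].

Definition collinear (R : realType) (S : set 'rV[R]_3) : Prop :=
  exists p d : 'rV[R]_3, S `<=` [set q | exists t : R, q = p + t *: d].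

Definition polar_plane (R : realType) (alpha beta gamma : R) (p : 'rV[R]_3) :
    set 'rV[R]_3 :=
  [set q | p 0 0 * q 0 0 / alpha + p 0 1 * q 0 1 / beta
           + p 0 2 * q 0 2 / gamma = 1].

Definition quad (n : rat * rat) : seq (rat * rat) :=
  [:: (n.1 - one_half, n.2 - one_half); (n.1 + one_half, n.2 - one_half);
      (n.1 + one_half, n.2 + one_half); (n.1 - one_half, n.2 + one_half)].

Definition edge1 (n : rat * rat) : seq (rat * rat) :=
  [:: (n.1 - one_half, n.2); (n.1 + one_half, n.2)].

Definition edge2 (n : rat * rat) : seq (rat * rat) :=
  [:: (n.1, n.2 - one_half); (n.1, n.2 + one_half)].

(* The plane P carries the quadrilateral around n. It is determined by n (so
   that one may call it the plane of the quadrilateral) exactly when the four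
   points r @` [set` quad n] are not collinear. *)
Definition quad_plane (R : realType) (r : rat * rat -> 'rV[R]_3)
    (n : rat * rat) (P : set 'rV[R]_3) : Prop :=
  is_plane P /\ r @` [set` quad n] `<=` P.

Definition binet_domain (U Us : set (rat * rat)) : Prop :=
  U `<=` Z2 /\ Us `<=` Z2_dual.

Definition principal_binet (R : realType) (U Us : set (rat * rat))
    (r : rat * rat -> 'rV[R]_3) : Prop :=
  [/\ binet_domain U Us,
      forall n, [set` quad n] `<=` U `|` Us -> exists P, quad_plane r n P
    & forall n, [set` edge1 n] `<=` U `|` Us -> [set` edge2 n] `<=` U `|` Us ->
        dot (r (n.1 + one_half, n.2) - r (n.1 - one_half, n.2))
            (r (n.1, n.2 + one_half) - r (n.1, n.2 - one_half)) = 0].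

(* Main.v *)
Require Import Defs.
From HB Require Import structures.
From mathcomp Require Import all_boot all_order all_algebra.
From mathcomp Require Import boolp classical_sets reals.
Set Implicit Arguments.
Unset Strict Implicit.
Unset Printing Implicit Defensive.
From mathcomp Require Import ring lra.
Import Order.TTheory GRing.Theory Num.Theory.
Local Open Scope classical_set_scope.
Local Open Scope ring_scope.

(** Along a half-step in either direction the functional equations say that the
  products F_i, G_i, H_i of neighbouring values of f_i, g_i, h_i satisfy
  [G1 = alpha - beta - F1], [H1 = alpha - gamma - F1],
  [G2 = F2 - (alpha - beta)], [H2 = alpha - gamma - F2].
  This is a discrete analogue of elliptic coordinates on the ellipsoid, and both
  claims become rational identities in the two parameters F1 and F2.

  Polarity: the four vertices of the quadrilateral around n are each half a
  step away from n in both directions, so the polar form of [r n] with such a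
  vertex is
  [F1 F2 / ((alpha - beta) (alpha - gamma))
   + G1 G2 / ((alpha - beta) (beta - gamma))
   + H1 H2 / ((alpha - gamma) (beta - gamma))],
  in which everything but the constant 1 cancels ([confocal_sum]). Hence all four
  vertices lie in the polar plane of [r n] ([confocal_polar]), which proves
  planarity as well. If n is not in the domain of the binet, the same
  formula still defines a point whose polar plane carries the quadrilateral:
  the indices n_i lie in the intervals J_i because both neighbours do.

  Orthogonality: in the scalar product of two dual edges each coordinate
  contributes a product of differences of F_i, G_i or H_i, and those differences
  agree up to sign with the ones of F_i. The scalar product is therefore
  the product of the differences of F1 and F2 times a combination of the squared
  normalizations, and that combination vanishes ([confocal_orthogonal]).

  Uniqueness of the plane is the fact that two distinct planes meet at most
  in a line ([plane_unique]), proved with the cross product. *)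

(** * Vectors and planes in three-space *)

Lemma vec3E (R : realType) (x y z : R) :
  (vec3 x y z 0 0 = x) * (vec3 x y z 0 1 = y) * (vec3 x y z 0 2 = z).
Proof. by rewrite !mxE. Qed.

Lemma dotE (R : realType) (u v : 'rV[R]_3) :
  dot u v = u 0 0 * v 0 0 + u 0 1 * v 0 1 + u 0 2 * v 0 2.
Proof.
rewrite /dot !big_ord_recl big_ord0 addr0 addrA.
have -> : lift ord0 ord0 = 1 :> 'I_3 by apply: val_inj.
by have -> : lift ord0 (lift ord0 ord0) = 2 :> 'I_3 by apply: val_inj.
Qed.

Lemma row3P (R : realType) (u v : 'rV[R]_3) :
  u 0 0 = v 0 0 -> u 0 1 = v 0 1 -> u 0 2 = v 0 2 -> u = v.
Proof.
move=> e0 e1 e2; apply/rowP; case=> [[|[|[|//]]] lt_i3].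
- by have -> : Ordinal lt_i3 = 0 by apply: val_inj.
- by have -> : Ordinal lt_i3 = 1 by apply: val_inj.
- by have -> : Ordinal lt_i3 = 2 by apply: val_inj.
Qed.

Lemma dotZl (R : realType) (t : R) (u v : 'rV[R]_3) :
  dot (t *: u) v = t * dot u v.
Proof. by rewrite !dotE !mxE; ring. Qed.

Lemma dotBr (R : realType) (u v w : 'rV[R]_3) :
  dot u (v - w) = dot u v - dot u w.
Proof. by rewrite !dotE !mxE; ring. Qed.

Lemma dot_self_eq0 (R : realType) (u : 'rV[R]_3) : dot u u = 0 -> u = 0.
Proof.
rewrite dotE => duu0.
have := sqr_ge0 (u 0 0); have := sqr_ge0 (u 0 1); have := sqr_ge0 (u 0 2).
move=> q2 q1 q0.
have sq0 (x : R) : x ^+ 2 = 0 -> x = 0 by move/eqP; rewrite sqrf_eq0 => /eqP.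
by apply: row3P; rewrite mxE; apply: sq0; lra.
Qed.

Definition cross (R : realType) (u v : 'rV[R]_3) : 'rV[R]_3 :=
  vec3 (u 0 1 * v 0 2 - u 0 2 * v 0 1)
       (u 0 2 * v 0 0 - u 0 0 * v 0 2)
       (u 0 0 * v 0 1 - u 0 1 * v 0 0).

(** The Grassmann identity [v x (u x v) = (v . v) u - (u . v) v] exhibits the
  proportionality factor as [(u . v) / (v . v)]. *)
Lemma cross_eq0_proportional (R : realType) (u v : 'rV[R]_3) :
  cross u v = 0 -> v != 0 -> exists t, u = t *: v.
Proof.
move=> uv0 v_neq0; exists (dot u v / dot v v).
have vv_neq0 : dot v v != 0 by apply: contra_neq v_neq0 => /dot_self_eq0.
have grassmann : dot v v *: u - dot u v *: v = cross v (cross u v).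
  by apply: row3P; rewrite /cross !vec3E !mxE !dotE /=; ring.
have cross0 : cross v 0 = 0.
  by apply: row3P; rewrite /cross !vec3E !mxE; ring.
have /eqP := grassmann; rewrite uv0 cross0 subr_eq0 => /eqP vv_u.
by rewrite mulrC -scalerA -vv_u scalerA mulVf // scale1r.
Qed.

(** Again by the Grassmann identity, now as
  [w x (u x v) = (w . v) u - (w . u) v]: the common normal of u and v spans
  their orthogonal complement. *)
Lemma cross_cross_orthogonal (R : realType) (u v w : 'rV[R]_3) :
  dot u w = 0 -> dot v w = 0 -> cross w (cross u v) = 0.
Proof.
move=> uw0 vw0.
suff -> : cross w (cross u v) = dot v w *: u - dot u w *: v.
  by rewrite uw0 vw0 !scale0r subrr.
by apply: row3P; rewrite /cross !vec3E !mxE !dotE /=; ring.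
Qed.

(** Non-parallel planes meet in a line directed by the cross product of their
  normals; parallel planes with a common point coincide. *)
Lemma plane_unique (R : realType) (S P Q : set 'rV[R]_3) :
  is_plane P -> is_plane Q -> S `<=` P -> S `<=` Q -> ~ collinear S -> P = Q.
Proof.
move=> [a [c [a_neq0 ->]]] [b [d [b_neq0 ->]]] SP SQ not_line.
have [p Sp] : exists p, S p.
  apply: contrapT => noS; apply: not_line; exists 0, 0 => q Sq.
  by case: noS; exists q.
have ap : dot a p = c := SP p Sp.
have bp : dot b p = d := SQ p Sp.
have ab0 : cross a b = 0.
  have [//|ab_neq0] := eqVneq (cross a b) 0.
  case: not_line; exists p, (cross a b) => q Sq /=.
  have aq : dot a q = c := SP q Sq.
  have bq : dot b q = d := SQ q Sq.
  have [t qpE] : exists t, q - p = t *: cross a b.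
    apply: cross_eq0_proportional => //; apply: cross_cross_orthogonal.
      by rewrite dotBr aq ap subrr.
    by rewrite dotBr bq bp subrr.
  by exists t; rewrite -qpE addrC subrK.
have [t aE] := cross_eq0_proportional ab0 b_neq0.
have t_neq0 : t != 0 by apply: contra_neq a_neq0 => t0; rewrite aE t0 scale0r.
apply/seteqP; split=> q /=; rewrite -ap -bp aE !dotZl.
  by move/(mulfI t_neq0).
by move->.
Qed.

Lemma polar_plane_neq0 (R : realType) (alpha beta gamma : R)
    (p q : 'rV[R]_3) : polar_plane alpha beta gamma p q -> p != 0.
Proof.
apply: contraPneq => ->; rewrite /polar_plane /= !mxE !mul0r !addr0 => /esym/eqP.
by rewrite oner_eq0.
Qed.

Lemma polar_plane_is_plane (R : realType) (alpha beta gamma : R)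
    (p q : 'rV[R]_3) :
  polar_plane alpha beta gamma p q -> is_plane (polar_plane alpha beta gamma p).
Proof.
move=> pq.
pose a := vec3 (p 0 0 / alpha) (p 0 1 / beta) (p 0 2 / gamma).
have aE v : dot a v = p 0 0 * v 0 0 / alpha + p 0 1 * v 0 1 / beta
                      + p 0 2 * v 0 2 / gamma.
  by rewrite dotE /a !vec3E; ring.
exists a, 1; split; last by apply/seteqP; split=> v /=; rewrite aE.
(* a vanishing normal would make the equation of the plane read 0 = 1 at q *)
apply: contraPneq pq => a0; rewrite /polar_plane /= -aE a0 dotE !mxE !mul0r.
by rewrite !addr0 => /esym/eqP; rewrite oner_eq0.
Qed.

(** * Half-steps in an interval of half-integers *)

Definition half_step (m n : rat) : Prop := m = n - one_half \/ m = n + one_half.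

Lemma half_step_product (R : realType) (J : set rat) (m n : rat) :
  J m -> J n -> half_step m n ->
  exists k, [/\ J k, J (k + one_half)
    & forall f : rat -> R, f n * f m = discrete_square f k].
Proof.
move=> Jm Jn [] mE; last first.
  by exists n; split=> // [|f]; rewrite -?mE // /discrete_square -mE.
exists m; have mnE : m + one_half = n by rewrite mE subrK.
by split=> // [|f]; rewrite /discrete_square ?mnE // mulrC.
Qed.

Lemma half_integer_interval_mid (J : set rat) (n : rat) :
  half_integer_interval J -> J (n - one_half) -> J (n + one_half) -> J n.
Proof.
move=> [J_half J_convex] Jm Jp; apply: (J_convex _ _ _ Jm Jp).
  have := J_half _ Jm; rewrite /half_integers /=.
  have -> : (n - one_half) *+ 2 = n *+ 2 - 1 by rewrite /one_half; field.
  by move=> n_int; rewrite -(subrK 1 (n *+ 2)) rpredD ?rpred1.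
by rewrite /one_half; apply/andP; split; lra.
Qed.

(** * Discrete confocal coordinates on the ellipsoid *)

Definition confocal_point (R : realType) (alpha beta gamma : R)
    (f1 f2 g1 g2 h1 h2 : rat -> R) (n : rat * rat) : 'rV[R]_3 :=
  vec3 (Num.sqrt (alpha / ((alpha - beta) * (alpha - gamma))) * f1 n.1 * f2 n.2)
       (Num.sqrt (beta / ((alpha - beta) * (beta - gamma))) * g1 n.1 * g2 n.2)
       (Num.sqrt (gamma / ((alpha - gamma) * (beta - gamma)))
          * h1 n.1 * h2 n.2).

Lemma sqr_confocal_scales (R : realType) (alpha beta gamma : R) :
  beta < alpha -> gamma < beta -> 0 < gamma ->
  [/\ Num.sqrt (alpha / ((alpha - beta) * (alpha - gamma))) ^+ 2
        = alpha / ((alpha - beta) * (alpha - gamma)),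
      Num.sqrt (beta / ((alpha - beta) * (beta - gamma))) ^+ 2
        = beta / ((alpha - beta) * (beta - gamma))
    & Num.sqrt (gamma / ((alpha - gamma) * (beta - gamma))) ^+ 2
        = gamma / ((alpha - gamma) * (beta - gamma))].
Proof.
move=> ab bg g0.
by split; apply: sqr_sqrtr; rewrite divr_ge0 ?mulr_ge0 //; lra.
Qed.

Lemma confocal_sum (R : realType) (alpha beta gamma : R)
    (F1 G1 H1 F2 G2 H2 : R) :
  beta < alpha -> gamma < beta ->
  F1 + G1 = alpha - beta -> F1 + H1 = alpha - gamma ->
  F2 - G2 = alpha - beta -> F2 + H2 = alpha - gamma ->
  F1 * F2 / ((alpha - beta) * (alpha - gamma))
  + G1 * G2 / ((alpha - beta) * (beta - gamma))
  + H1 * H2 / ((alpha - gamma) * (beta - gamma)) = 1.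
Proof.
move=> ab bg fg1 fh1 fg2 fh2.
have -> : G1 = alpha - beta - F1 by rewrite -fg1; ring.
have -> : H1 = alpha - gamma - F1 by rewrite -fh1; ring.
have -> : G2 = F2 - (alpha - beta) by rewrite -fg2; ring.
have -> : H2 = alpha - gamma - F2 by rewrite -fh2; ring.
by field; apply/and3P; split; apply: lt0r_neq0; lra.
Qed.

(** Points at half a step from each other in both directions are conjugate with
  respect to the ellipsoid: their polar form splits into the products of
  neighbouring values that [confocal_sum] evaluates. *)
Lemma confocal_polar (R : realType) (alpha beta gamma : R)
    (J1 J2 : set rat) (f1 f2 g1 g2 h1 h2 : rat -> R) (m n : rat * rat) :
  beta < alpha -> gamma < beta -> 0 < gamma ->
  (forall k, J1 k -> J1 (k + one_half) ->
     discrete_square f1 k + discrete_square g1 k = alpha - beta) ->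
  (forall k, J1 k -> J1 (k + one_half) ->
     discrete_square f1 k + discrete_square h1 k = alpha - gamma) ->
  (forall k, J2 k -> J2 (k + one_half) ->
     discrete_square f2 k - discrete_square g2 k = alpha - beta) ->
  (forall k, J2 k -> J2 (k + one_half) ->
     discrete_square f2 k + discrete_square h2 k = alpha - gamma) ->
  (J1 `*` J2) m -> (J1 `*` J2) n ->
  half_step m.1 n.1 -> half_step m.2 n.2 ->
  polar_plane alpha beta gamma
    (confocal_point alpha beta gamma f1 f2 g1 g2 h1 h2 n)
    (confocal_point alpha beta gamma f1 f2 g1 g2 h1 h2 m).
Proof.
move=> ab bg g0 fg1 fh1 fg2 fh2 [Jm1 Jm2] [Jn1 Jn2] step1 step2.
have [k1 [Jk1 Jk1' ds1]] := half_step_product R Jm1 Jn1 step1.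
have [k2 [Jk2 Jk2' ds2]] := half_step_product R Jm2 Jn2 step2.
have [sA sB sC] := sqr_confocal_scales ab bg g0.
rewrite /polar_plane /= /confocal_point !vec3E.
set A := Num.sqrt (alpha / _) in sA *.
set B := Num.sqrt (beta / _) in sB *.
set C := Num.sqrt (gamma / _) in sC *.
have regroup (s x1 x2 x1' x2' d : R) :
    s * x1 * x2 * (s * x1' * x2') / d = s ^+ 2 / d * ((x1 * x1') * (x2 * x2')).
  by ring.
rewrite !regroup !ds1 !ds2 sA sB sC.
rewrite -(confocal_sum ab bg (fg1 _ Jk1 Jk1') (fh1 _ Jk1 Jk1')
                       (fg2 _ Jk2 Jk2') (fh2 _ Jk2 Jk2')).
by field; do ![apply/andP; split]; apply: lt0r_neq0; lra.
Qed.

(** Since the differences of the G_i and H_i are those of the F_i up to sign,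
  everything reduces to
  [alpha (beta - gamma) - beta (alpha - gamma) + gamma (alpha - beta) = 0]. *)
Lemma confocal_orthogonal (R : realType) (alpha beta gamma : R)
    (J1 J2 : set rat) (f1 f2 g1 g2 h1 h2 : rat -> R) (n : rat * rat) :
  beta < alpha -> gamma < beta -> 0 < gamma ->
  (forall k, J1 k -> J1 (k + one_half) ->
     discrete_square f1 k + discrete_square g1 k = alpha - beta) ->
  (forall k, J1 k -> J1 (k + one_half) ->
     discrete_square f1 k + discrete_square h1 k = alpha - gamma) ->
  (forall k, J2 k -> J2 (k + one_half) ->
     discrete_square f2 k - discrete_square g2 k = alpha - beta) ->
  (forall k, J2 k -> J2 (k + one_half) ->
     discrete_square f2 k + discrete_square h2 k = alpha - gamma) ->
  J1 (n.1 - one_half) -> J1 n.1 -> J1 (n.1 + one_half) ->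
  J2 (n.2 - one_half) -> J2 n.2 -> J2 (n.2 + one_half) ->
  let p := confocal_point alpha beta gamma f1 f2 g1 g2 h1 h2 in
  dot (p (n.1 + one_half, n.2) - p (n.1 - one_half, n.2))
      (p (n.1, n.2 + one_half) - p (n.1, n.2 - one_half)) = 0.
Proof.
case: n => n1 n2 /= ab bg g0 fg1 fh1 fg2 fh2 J1m J1n J1p J2m J2n J2p.
have [sA sB sC] := sqr_confocal_scales ab bg g0.
have subE (u v : 'rV[R]_3) i : (u - v) 0 i = u 0 i - v 0 i by rewrite !mxE.
rewrite dotE !subE /confocal_point !vec3E /=.
set A := Num.sqrt (alpha / _) in sA *.
set B := Num.sqrt (beta / _) in sB *.
set C := Num.sqrt (gamma / _) in sC *.
have diff1 f : f (n1 + one_half) * f n1 - f (n1 - one_half) * f n1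
    = discrete_square f n1 - discrete_square f (n1 - one_half) :> R.
  by rewrite /discrete_square subrK (mulrC (f n1)).
have diff2 f : f (n2 + one_half) * f n2 - f (n2 - one_half) * f n2
    = discrete_square f n2 - discrete_square f (n2 - one_half) :> R.
  by rewrite /discrete_square subrK (mulrC (f n2)).
have regroup (s xp xm x yp ym y : R) :
    (s * xp * y - s * xm * y) * (s * x * yp - s * x * ym)
    = s ^+ 2 * ((xp * x - xm * x) * (yp * y - ym * y)).
  by ring.
have J1m' : J1 (n1 - one_half + one_half) by rewrite subrK.
have J2m' : J2 (n2 - one_half + one_half) by rewrite subrK.
have dG1 : discrete_square g1 n1 - discrete_square g1 (n1 - one_half)
    = - (discrete_square f1 n1 - discrete_square f1 (n1 - one_half)).
  by have := fg1 _ J1n J1p; have := fg1 _ J1m J1m'; lra.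
have dH1 : discrete_square h1 n1 - discrete_square h1 (n1 - one_half)
    = - (discrete_square f1 n1 - discrete_square f1 (n1 - one_half)).
  by have := fh1 _ J1n J1p; have := fh1 _ J1m J1m'; lra.
have dG2 : discrete_square g2 n2 - discrete_square g2 (n2 - one_half)
    = discrete_square f2 n2 - discrete_square f2 (n2 - one_half).
  by have := fg2 _ J2n J2p; have := fg2 _ J2m J2m'; lra.
have dH2 : discrete_square h2 n2 - discrete_square h2 (n2 - one_half)
    = - (discrete_square f2 n2 - discrete_square f2 (n2 - one_half)).
  by have := fh2 _ J2n J2p; have := fh2 _ J2m J2m'; lra.
rewrite !regroup !diff1 !diff2 dG1 dG2 dH1 dH2 sA sB sC.
by field; apply/and3P; split; apply: lt0r_neq0; lra.
Qed.

(** * The binet *)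

Theorem theorem4p3 (R : realType) (alpha beta gamma : R)
    (h_ab : beta < alpha) (h_bg : gamma < beta) (h_g : 0 < gamma)
    (U Us : set (rat * rat)) (hU : binet_domain U Us)
    (J1 J2 : set rat)
    (hJ1 : half_integer_interval J1) (hJ2 : half_integer_interval J2)
    (hUJ : U `|` Us `<=` J1 `*` J2)
    (f1 f2 g1 g2 h1 h2 : rat -> R)
    (hfg1 : forall n, J1 n -> J1 (n + one_half) ->
       discrete_square f1 n + discrete_square g1 n = alpha - beta)
    (hfh1 : forall n, J1 n -> J1 (n + one_half) ->
       discrete_square f1 n + discrete_square h1 n = alpha - gamma)
    (hfg2 : forall n, J2 n -> J2 (n + one_half) ->
       discrete_square f2 n - discrete_square g2 n = alpha - beta)
    (hfh2 : forall n, J2 n -> J2 (n + one_half) ->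
       discrete_square f2 n + discrete_square h2 n = alpha - gamma)
    (r : rat * rat -> 'rV[R]_3)
    (hr : forall n, (U `|` Us) n ->
       r n = vec3
         (Num.sqrt (alpha / ((alpha - beta) * (alpha - gamma)))
            * f1 n.1 * f2 n.2)
         (Num.sqrt (beta / ((alpha - beta) * (beta - gamma)))
            * g1 n.1 * g2 n.2)
         (Num.sqrt (gamma / ((alpha - gamma) * (beta - gamma)))
            * h1 n.1 * h2 n.2)) :
  principal_binet U Us r /\
  (forall n, (U `|` Us) n -> [set` quad n] `<=` U `|` Us ->
     [/\ r n != 0,
         quad_plane r n (polar_plane alpha beta gamma (r n))
       & ~ collinear (r @` [set` quad n]) ->
         forall P, quad_plane r n P ->
           P = polar_plane alpha beta gamma (r n)]).
Proof.
pose p := confocal_point alpha beta gamma f1 f2 g1 g2 h1 h2.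
have rE m : (U `|` Us) m -> r m = p m := hr m.
have mid n : [set` quad n] `<=` U `|` Us -> (J1 `*` J2) n.
  move=> quad_dom.
  have [/= J1m J2m] := hUJ _ (quad_dom (n.1 - one_half, n.2 - one_half)
    ltac:(by rewrite /= /quad !inE eqxx)).
  have [/= J1p J2p] := hUJ _ (quad_dom (n.1 + one_half, n.2 + one_half)
    ltac:(by rewrite /= /quad !inE eqxx !orbT)).
  by split; apply: half_integer_interval_mid.
have in_polar n m : [set` quad n] `<=` U `|` Us -> m \in quad n ->
    polar_plane alpha beta gamma (p n) (r m).
  move=> quad_dom m_quad; have m_dom := quad_dom m m_quad.
  rewrite rE //; apply: (confocal_polar h_ab h_bg h_g hfg1 hfh1 hfg2 hfh2).
  - exact: hUJ.
  - exact: mid.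
  - by move: m_quad; rewrite !inE => /or4P[] /eqP-> /=; [left|right|right|left].
  - by move: m_quad; rewrite !inE => /or4P[] /eqP-> /=; [left|left|right|right].
have some_vertex n : (n.1 - one_half, n.2 - one_half) \in quad n.
  by rewrite /quad inE eqxx.
have polar_carries n : [set` quad n] `<=` U `|` Us ->
    quad_plane r n (polar_plane alpha beta gamma (p n)).
  move=> quad_dom; split.
    exact: polar_plane_is_plane (in_polar n _ quad_dom (some_vertex n)).
  by move=> _ [m m_quad <-]; apply: in_polar.
split; first split=> //.
- move=> n quad_dom; exists (polar_plane alpha beta gamma (p n)).
  exact: polar_carries.
- move=> n edge1_dom edge2_dom.
  have dom1m : (U `|` Us) (n.1 - one_half, n.2).
    by apply: edge1_dom; rewrite /= /edge1 !inE eqxx.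
  have dom1p : (U `|` Us) (n.1 + one_half, n.2).
    by apply: edge1_dom; rewrite /= /edge1 !inE eqxx orbT.
  have dom2m : (U `|` Us) (n.1, n.2 - one_half).
    by apply: edge2_dom; rewrite /= /edge2 !inE eqxx.
  have dom2p : (U `|` Us) (n.1, n.2 + one_half).
    by apply: edge2_dom; rewrite /= /edge2 !inE eqxx orbT.
  have [/= J1m J2n] := hUJ _ dom1m; have [/= J1p _] := hUJ _ dom1p.
  have [/= J1n J2m] := hUJ _ dom2m; have [/= _ J2p] := hUJ _ dom2p.
  rewrite !rE //.
  exact: (confocal_orthogonal h_ab h_bg h_g hfg1 hfh1 hfg2 hfh2).
- move=> n n_dom quad_dom; rewrite rE //.
  have carries := polar_carries n quad_dom.
  split=> //.
    exact: polar_plane_neq0 (in_polar n _ quad_dom (some_vertex n)).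
  move=> not_line P [P_plane P_sub].
  by have [Q_plane Q_sub] := carries; apply: (plane_unique (S := r @` [set` quad n])).
Qed.
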